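(* A Riemannian metric tensor $g$ on the $3$-dimensional Heisenberg group $\mathbb{H}_3$ determines a $\mathbb{Z}_2^2$-symmetric Riemannian structure on $\mathbb{H}_3$ (that is, there is a $\mathbb{Z}_2^2$-symmetric structure on $\mathbb{H}_3$ for which $g$ is a $\mathbb{Z}_2^2$-symmetric Riemannian metric) if and only if $g$ is a left-invariant metric on $\mathbb{H}_3$.
   Context: $\mathbb{H}_3$ is the group of real upper triangular unipotent $3\times 3$ matrices, with Lie algebra $\mathfrak{h}_3$. A subgroup $\Gamma\subset \mathrm{Aut}(\mathfrak{h}_3)$ isomorphic to $\mathbb{Z}_2^2=(\mathbb{Z}/2\mathbb{Z})^2$ consists of commuting involutive automorphisms, and its simultaneous eigenspace decomposition is a $\mathbb{Z}_2^2$-grading $\mathfrak{h}_3=\bigoplus_{\gamma\in\mathbb{Z}_2^2}\mathfrak{g}_\gamma$ with $[\mathfrak{g}_\gamma,\mathfrak{g}_{\gamma'}]\subset\mathfrak{g}_{\gamma\gamma'}$, where $\mathfrak{g}_\epsilon$ ($\epsilon$ the unit of $\mathbb{Z}_2^2$) is the space of vectors fixed by $\Gamma$. A $\mathbb{Z}_2^2$-symmetric structure on $\mathbb{H}_3=\mathbb{H}_3/\{e\}$ is the structure given by such a grading (with $\mathfrak{g}_\epsilon=\{0\}$, so the isotropy subgroup $H$ is trivial). A $\mathbb{Z}_2^2$-symmetric Riemannian metric for this structure is an $\mathbb{H}_3$-invariant (i.e. left-invariant) Riemannian metric $g$ on $\mathbb{H}_3$ whose associated inner product on $\mathfrak{h}_3$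 makes the components $\mathfrak{g}_\gamma$, $\gamma\neq\epsilon$, pairwise orthogonal. *)

(* Defs.v *)
From HB Require Import structures.
From mathcomp Require Import all_boot all_order all_algebra.
From mathcomp Require Import all_classical all_reals all_analysis.
From mathcomp Require Import ring.

Set Implicit Arguments.
Unset Strict Implicit.
Unset Printing Implicit Defensive.

Import Order.TTheory GRing.Theory Num.Theory.
Import numFieldNormedType.Exports.

Local Open Scope classical_set_scope.
Local Open Scope ring_scope.

Local Notation i0 := (@Ordinal 3 0 isT).
Local Notation i1 := (@Ordinal 3 1 isT).
Local Notation i2 := (@Ordinal 3 2 isT).

Section Heisenberg.
Variable R : realType.

Definition unipotent (x : 'M[R]_3) : bool :=
  [forall i : 'I_3, forall j : 'I_3, (j <= i)%N ==> (x i j == (i == j)%:R)].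

Record heis := Heis { heis_mx :> 'M[R]_3; heis_unipotent : unipotent heis_mx }.

HB.instance Definition _ := [isSub for heis_mx].
HB.instance Definition _ := [Choice of heis by <:].

Definition strict_utmx (a b c : R) : 'M[R]_3 :=
  a *: delta_mx i0 i1 + b *: delta_mx i1 i2 + c *: delta_mx i0 i2.

Definition utmx (a b c : R) : 'M[R]_3 := 1%:M + strict_utmx a b c.

Lemma utmx_unipotent a b c : unipotent (utmx a b c).
Proof.
apply/forallP => -[[|[|[|//]]] ?]; apply/forallP => -[[|[|[|//]]] ?] //=;
  by rewrite !mxE -!val_eqE /= ?mulr0 ?mulr1 ?addr0.
Qed.

Lemma unipotentE x : unipotent x -> x = utmx (x i0 i1) (x i1 i2) (x i0 i2).
Proof.
move=> /forallP H; apply/matrixP => i j.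
case: (leqP j i) => ij.
  have /forallP/(_ j)/implyP/(_ ij)/eqP-> := H i.
  have /forallP/(_ i)/forallP/(_ j)/implyP/(_ ij)/eqP-> //:=
     utmx_unipotent (x i0 i1) (x i1 i2) (x i0 i2).
move: i j ij => [[|[|[|//]]] ?] [[|[|[|//]]] ?] //= _;
rewrite !mxE -!val_eqE /= ?mulr0 ?mulr1 ?addr0 ?add0r; congr (x _ _); exact/val_inj.
Qed.

Lemma mulmx_utmx a b c a' b' c' :
  utmx a b c *m utmx a' b' c' = utmx (a + a') (b + b') (c + c' + a * b').
Proof.
apply/matrixP => -[[|[|[|//]]] ?] [[|[|[|//]]] ?];
rewrite !mxE !big_ord_recl big_ord0 !mxE -!val_eqE /=; ring.
Qed.

Lemma unipotentM (x y : heis) : unipotent (x *m y).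
Proof.
by rewrite (unipotentE (valP x)) (unipotentE (valP y)) mulmx_utmx utmx_unipotent.
Qed.

Lemma unipotent1 : unipotent 1%:M.
Proof.
by apply/forallP => i; apply/forallP => j; apply/implyP => _; rewrite mxE.
Qed.

Lemma utmx_inv a b c :
  utmx a b c *m utmx (- a) (- b) (a * b - c) = 1%:M /\
  utmx (- a) (- b) (a * b - c) *m utmx a b c = 1%:M.
Proof.
rewrite !mulmx_utmx /utmx /strict_utmx; split; rewrite -[RHS]addr0;
  congr (_ + _); apply/matrixP => i j; rewrite !mxE; ring.
Qed.

Lemma unipotentV (x : heis) : unipotent (invmx x).
Proof.
have [a [b [c ->]]] : exists a b c, heis_mx x = utmx a b c.
  by do 3!eexists; exact: unipotentE (heis_unipotent x).
have [h1 h2] := utmx_inv a b c.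
have [u _] := mulmx1_unit h1.
have -> : invmx (utmx a b c) = utmx (- a) (- b) (a * b - c).
  by rewrite -[LHS]mulmx1 -h1 mulKmx.
exact: utmx_unipotent.
Qed.

Lemma heis_unitmx (x : heis) : heis_mx x \in unitmx.
Proof.
rewrite (unipotentE (valP x)).
by have [h _] := utmx_inv (x i0 i1) (x i1 i2) (x i0 i2); case: (mulmx1_unit h).
Qed.

Definition heis_mul (x y : heis) := Heis (unipotentM x y).
Definition heis_one := Heis unipotent1.
Definition heis_inv (x : heis) := Heis (unipotentV x).

Fact heis_mulA : associative heis_mul.
Proof. by move=> x y z; apply/val_inj; rewrite /= mulmxA. Qed.
Fact heis_mul1 : left_id heis_one heis_mul.
Proof. by move=> x; apply/val_inj; rewrite /= mul1mx. Qed.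
Fact heis_mulr1 : right_id heis_one heis_mul.
Proof. by move=> x; apply/val_inj; rewrite /= mulmx1. Qed.
Fact heis_mulV : left_inverse heis_one heis_inv heis_mul.
Proof. by move=> x; apply/val_inj; rewrite /= mulVmx ?heis_unitmx. Qed.
Fact heis_mulrV : right_inverse heis_one heis_inv heis_mul.
Proof. by move=> x; apply/val_inj; rewrite /= mulmxV ?heis_unitmx. Qed.

HB.instance Definition _ :=
  isGroup.Build heis heis_mulA heis_mul1 heis_mulr1 heis_mulV heis_mulrV.

(* The global chart of the manifold heis. *)
Definition chart (u : 'rV[R]_3) : heis :=
  Heis (utmx_unipotent (u 0 i0) (u 0 i1) (u 0 i2)).

(* The Lie algebra is the space of strictly upper triangular matrices.  Since
   heis is the affine subspace 1 + h3 of 'M_3, h3 is also the tangent space of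
   heis at every point x, and not only at the identity. *)
Definition h3 : {vspace 'M[R]_3} :=
  <<[:: delta_mx i0 i1; delta_mx i1 i2; delta_mx i0 i2]>>%VS.

Lemma strict_utmx_h3 a b c : strict_utmx a b c \in h3.
Proof.
by rewrite !memvD ?memvZ // memv_span // !inE eqxx ?orbT.
Qed.

Lemma h3P (v : 'M[R]_3) :
  reflect (exists a b c, v = strict_utmx a b c) (v \in h3).
Proof.
apply: (iffP idP) => [|[a [b [c ->]]]]; last exact: strict_utmx_h3.
rewrite /h3 !span_cons span_nil addv0 => /memv_addP[_ /vlineP[a ->]].
move=> [_ /memv_addP[_ /vlineP[b ->] [_ /vlineP[c ->] ->]] ->].
by exists a, b, c; rewrite addrA.
Qed.

Lemma h3_mx (v : 'M[R]_3) :
  (v \in h3) = [forall i : 'I_3, forall j : 'I_3, (j <= i)%N ==> (v i j == 0)].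
Proof.
apply/h3P/idP => [[a [b [c ->]]]|/forallP H].
  apply/forallP => -[[|[|[|//]]] ?]; apply/forallP => -[[|[|[|//]]] ?] //=;
  by rewrite !mxE -!val_eqE /= ?mulr0 ?mulr1 ?addr0.
exists (v i0 i1), (v i1 i2), (v i0 i2); apply/matrixP => i j.
case: (leqP j i) => ij.
  have /forallP/(_ j)/implyP/(_ ij)/eqP-> := H i.
  move: i j ij => [[|[|[|//]]] ?] [[|[|[|//]]] ?] //= _;
  by rewrite !mxE -!val_eqE /= ?mulr0 ?mulr1 ?addr0.
move: i j ij => [[|[|[|//]]] ?] [[|[|[|//]]] ?] //= _;
rewrite !mxE -!val_eqE /= ?mulr0 ?mulr1 ?addr0 ?add0r; congr (v _ _); exact/val_inj.
Qed.

Local Notation lieh := (subvs_of h3).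

Lemma bracket_h3 (u v : lieh) : vsval u *m vsval v - vsval v *m vsval u \in h3.
Proof.
have /h3P[a [b [c ->]]] := valP u; have /h3P[a' [b' [c' ->]]] := valP v.
apply/h3P; exists 0, 0, (a * b' - a' * b).
apply/matrixP => -[[|[|[|//]]] ?] [[|[|[|//]]] ?];
rewrite !mxE !big_ord_recl !big_ord0 !mxE -!val_eqE /=; ring.
Qed.

Definition bracket (u v : lieh) : lieh := Subvs (bracket_h3 u v).

Lemma heis_mul_h3 (x : heis) (v : lieh) : heis_mx x *m vsval v \in h3.
Proof.
have /h3P[a [b [c ->]]] := valP v; rewrite (unipotentE (valP x)).
apply/h3P; exists a, b, (c + x i0 i1 * b).
apply/matrixP => -[[|[|[|//]]] ?] [[|[|[|//]]] ?];
rewrite !mxE !big_ord_recl !big_ord0 !mxE -!val_eqE /=; ring.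
Qed.

(* The differential, at any point, of the left translation y |-> x * y: this
   translation is the restriction of a linear endomorphism of 'M_3. *)
Definition dleft (x : heis) (v : lieh) : lieh := Subvs (heis_mul_h3 x v).

(* Continuity of all iterated partial derivatives of order at most k. *)
Fixpoint C_k (k : nat) (f : 'rV[R]_3 -> R) : Prop :=
  if k is k'.+1 then
    continuous f /\
    (forall i : 'I_3, (forall u, derivable f u (delta_mx 0 i)) /\
                      C_k k' (fun u => 'D_(delta_mx 0 i) f u))
  else continuous f.

Definition smooth (f : 'rV[R]_3 -> R) : Prop := forall k, C_k k f.

Record riemannian_metric := RiemannianMetric {
  metric :> heis -> lieh -> lieh -> R;
  metric_sym : forall x v w, metric x v w = metric x w v;
  metric_linear : forall x w, scalar (metric x ^~ w);
  metric_pos : forall x v, v != 0 -> 0 < metric x v v;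
  metric_smooth : forall v w, smooth (fun u => metric (chart u) v w)
}.

Definition left_invariant (g : riemannian_metric) : Prop :=
  forall (x y : heis) (v w : lieh),
    g (x * y)%g (dleft x v) (dleft x w) = g y v w.

Definition lie_automorphism (f : 'End(lieh)) : Prop :=
  bijective f /\ forall u v, f (bracket u v) = bracket (f u) (f v).

(* The group Z_2^2 in additive notation: its unit is 0. *)
Definition Z22 : Type := ('Z_2 * 'Z_2)%type.
HB.instance Definition _ := GRing.Zmodule.on Z22.
HB.instance Definition _ := Finite.on Z22.

(* Z22 is identified with its own group of characters:
   chi gamma a = (-1) ^ (gamma . a). *)
Definition chi (gamma a : Z22) : R :=
  (-1) ^+ (gamma.1 * a.1 + gamma.2 * a.2).

(* The simultaneous eigenspace of a family of endomorphisms indexed by Z22. *)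
Definition component (rho : Z22 -> 'End(lieh)) (gamma : Z22) : {vspace lieh} :=
  (\bigcap_(a : Z22) passmx.leigenspace (rho a) (chi gamma a))%VS.

(* The subgroup Gamma of Aut(h3) is the image of the embedding aut_of of Z22;
   the grading of h3 is component aut_of. *)
Record Z22_symmetric_structure := Z22SymmetricStructure {
  aut_of :> Z22 -> 'End(lieh);
  aut_of_lie : forall a, lie_automorphism (aut_of a);
  aut_ofD : forall a b, aut_of (a + b) = (aut_of a \o aut_of b)%VF;
  aut_of_inj : injective aut_of;
  aut_of_fixed : component aut_of 0 = 0%VS
}.

Definition Z22_symmetric_metric
    (S : Z22_symmetric_structure) (g : riemannian_metric) : Prop :=
  left_invariant g /\
  forall gamma gamma' : Z22, gamma != 0 -> gamma' != 0 -> gamma != gamma' ->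
  forall v w, v \in component S gamma -> w \in component S gamma' ->
  g 1%g v w = 0.

Lemma componentP (rho : Z22 -> 'End(lieh)) gamma v :
  reflect (forall a, rho a v = chi gamma a *: v) (v \in component rho gamma).
Proof.
rewrite /component memvE; apply: (iffP subv_bigcapP) => H a.
  move: (H a isT); rewrite -memvE memv_ker.
  by rewrite !lfunE /= !lfunE /= !lfunE /= !lfunE /= subr_eq0 => /eqP.
move=> _; rewrite -memvE memv_ker.
by rewrite !lfunE /= !lfunE /= !lfunE /= !lfunE /= H subrr.
Qed.

Lemma forall_Z22 (P : Z22 -> Prop) :
  P (0, 0) -> P (0, 1) -> P (1, 0) -> P (1, 1) -> forall a, P a.
Proof.
move=> h1 h2 h3 h4 [a b].
have E (c : 'Z_2) : c = 0 \/ c = 1.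
  by case: c => [[|[|//]] ?]; [left|right]; apply/val_inj.
by case: (E a) => ->; case: (E b) => ->.
Qed.

Lemma chiD gamma gamma' a : chi (gamma + gamma') a = chi gamma a * chi gamma' a.
Proof.
elim/forall_Z22: gamma; elim/forall_Z22: gamma'; elim/forall_Z22: a;
  rewrite /chi /= ?expr0 ?expr1 ?expr2; ring.
Qed.

Lemma chiC gamma a : chi gamma a = chi a gamma.
Proof. by rewrite /chi /= mulnC [X in (_ + X)%N]mulnC. Qed.

Lemma chi_sum a : \sum_gamma chi gamma a = if a == 0 then 4 else 0.
Proof.
rewrite -(pair_big xpredT xpredT (fun i j => chi (i, j) a)) /=.
rewrite !big_ord_recl !big_ord0 /=.
elim/forall_Z22: a; rewrite /chi /= ?expr0 ?expr1 ?expr2; ring.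
Qed.

(* component_bracket and component_direct: the components grade h3 by Z22. *)
Lemma component_bracket (S : Z22_symmetric_structure) gamma gamma' u v :
  u \in component S gamma -> v \in component S gamma' ->
  bracket u v \in component S (gamma + gamma').
Proof.
move=> /componentP hu /componentP hv; apply/componentP => a.
have [_ ->] := aut_of_lie S a; rewrite hu hv chiD; apply/val_inj => /=.
by rewrite -!scalemxAl -!scalemxAr !scalerA scalerBr [_ gamma' a * _]mulrC.
Qed.

Lemma aut_of0 (S : Z22_symmetric_structure) v : S 0 v = v.
Proof.
have [b _] := aut_of_lie S 0; apply: (bij_inj b).
by rewrite -{3}[0]addr0 aut_ofD lfunE.
Qed.

Lemma component_direct (S : Z22_symmetric_structure) :
  (\sum_gamma component S gamma)%VS = fullv /\
  directv (\sum_gamma component S gamma).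
Proof.
have n4 : (4 : R) != 0 by rewrite pnatr_eq0.
have chi2 gamma a : chi gamma a * chi gamma a = 1.
  by rewrite /chi -expr2 sqrr_sign.
split.
  apply/vspaceP => v; rewrite memvf.
  have -> : v = \sum_gamma (4^-1 *: \sum_a chi gamma a *: S a v).
    rewrite -scaler_sumr exchange_big /=.
    under eq_bigr do rewrite -scaler_suml chi_sum.
    rewrite (bigD1 0) //= big1 => [|a /negPf ->]; last by rewrite scale0r.
    by rewrite addr0 aut_of0 scalerA mulVf // scale1r.
  apply: memv_sumr => gamma _; apply/componentP => b.
  rewrite linearZ /= scalerA mulrC -scalerA; congr (_ *: _).
  rewrite linear_sum /= [in RHS](reindex_inj (addrI b)) /= scaler_sumr.
  apply: eq_bigr => a _; rewrite linearZ /= scalerA; congr (_ *: _).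
    by rewrite [chi gamma (b + a)]chiC chiD !(chiC _ gamma) mulrA chi2 mul1r.
  by rewrite aut_ofD lfunE.
apply/directv_sum_independent => w wP w0 gamma _.
apply: (scalerI n4); rewrite scaler0.
transitivity (\sum_b chi gamma b *: S b (\sum_gamma' w gamma')); last first.
  by rewrite w0 big1 // => b _; rewrite linear0 scaler0.
under eq_bigr => b _.
  rewrite linear_sum scaler_sumr /=.
  under eq_bigr => gamma' _ do
    rewrite (componentP _ _ _ (wP gamma' isT)) scalerA -chiD chiC.
  over.
rewrite exchange_big /=; under eq_bigr do rewrite -scaler_suml chi_sum.
rewrite (bigD1 gamma) //= big1 => [|gamma' ne].
  have -> : gamma + gamma = 0 by elim/forall_Z22: gamma; apply/eqP.
  by rewrite eqxx addr0.
case: eqP => [e|]; last by rewrite scale0r.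
case/eqP: ne; apply: (addrI gamma); rewrite e.
by apply/esym; elim/forall_Z22: (gamma); apply/eqP.
Qed.

End Heisenberg.

(* Main.v *)
Require Import Defs.
From HB Require Import structures.
From mathcomp Require Import all_boot all_order all_algebra.
From mathcomp Require Import all_classical all_reals all_analysis.
From mathcomp Require Import ring.

(** A symmetric metric is left-invariant by definition, so only the converse
    needs an argument.  A left-invariant metric is known from its inner product
    B on the Lie algebra.  Let E, F, Z be the matrix units at (0,1), (1,2) and
    (0,2), so that [E, F] = Z is central.  Gram-Schmidt applied to Z, E, F in
    this order gives B-orthogonal vectors Z, X = E + p Z and
    Y = F + q X + r Z ([exists_orthogonal_frame]).  Starting from the central
    vector is the point: the corrections then lose nothing in the bracket, and
    [X, Y] = Z still holds, whatever p, q, r are ([bracket_frame]).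

    The sign changes X -> s X, Y -> t Y, Z -> s t Z with s, t = 1 or -1
    therefore preserve the bracket, and they form a copy of Z_2^2
    ([frame_structure]).  On X, Y and Z this group acts by its three
    nontrivial characters, so the grading is 0 + <X> + <Y> + <Z>: its
    component at the unit is zero and its other components are the orthogonal
    lines spanned by X, Y and Z. *)

Set Implicit Arguments.
Unset Strict Implicit.
Unset Printing Implicit Defensive.

Import Order.TTheory GRing.Theory Num.Theory.

Local Open Scope ring_scope.

Local Notation i0 := (@Ordinal 3 0 isT).
Local Notation i1 := (@Ordinal 3 1 isT).
Local Notation i2 := (@Ordinal 3 2 isT).

(** * Frames of the Heisenberg algebra adapted to its center *)

Section Frame.
Context (R : realType) (p q r : R).
Local Notation lieh := (subvs_of (h3 R)).

(** The vector x X + y Y + z Z, where X = E + p Z and Y = F + q X + r Z. *)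
Definition frame (x y z : R) : lieh :=
  Subvs (strict_utmx_h3 (x + q * y) y (z + p * (x + q * y) + r * y)).

(** The coordinates with respect to X, Y, Z. *)
Definition coordX (v : lieh) : R := vsval v i0 i1 - q * vsval v i1 i2.
Definition coordY (v : lieh) : R := vsval v i1 i2.
Definition coordZ (v : lieh) : R :=
  vsval v i0 i2 - p * vsval v i0 i1 - r * vsval v i1 i2.

Lemma coordX_frame x y z : coordX (frame x y z) = x.
Proof. rewrite /coordX /= !mxE -!val_eqE /=; ring. Qed.

Lemma coordY_frame x y z : coordY (frame x y z) = y.
Proof. rewrite /coordY /= !mxE -!val_eqE /=; ring. Qed.

Lemma coordZ_frame x y z : coordZ (frame x y z) = z.
Proof. rewrite /coordZ /= !mxE -!val_eqE /=; ring. Qed.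

Definition coord_frame := (coordX_frame, coordY_frame, coordZ_frame).

Lemma frame_coord v : frame (coordX v) (coordY v) (coordZ v) = v.
Proof.
apply/val_inj => /=; have /h3P[a [b [c e]]] := valP v.
rewrite /coordX /coordY /coordZ /= e /strict_utmx.
by congr (_ *: _ + _ *: _ + _ *: _); rewrite !mxE -!val_eqE /=; ring.
Qed.

Lemma frameP v : exists x y z, v = frame x y z.
Proof. by exists (coordX v), (coordY v), (coordZ v); rewrite frame_coord. Qed.

Lemma scale_frame a x y z : a *: frame x y z = frame (a * x) (a * y) (a * z).
Proof.
apply/val_inj; rewrite /= /strict_utmx !scalerDr !scalerA.
by congr (_ *: _ + _ *: _ + _ *: _); ring.
Qed.

Lemma add_frame x y z x' y' z' :
  frame x y z + frame x' y' z' = frame (x + x') (y + y') (z + z').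
Proof. by apply/val_inj/matrixP => i j; rewrite /= !mxE; ring. Qed.

Lemma frame_basis x y z :
  frame x y z = x *: frame 1 0 0 + (y *: frame 0 1 0 + z *: frame 0 0 1).
Proof. by rewrite !scale_frame !add_frame; congr frame; ring. Qed.

(** Modulo the center, X is E and Y is F + q E, so that [X, Y] = [E, F] = Z. *)
Lemma bracket_frame x y z x' y' z' :
  bracket (frame x y z) (frame x' y' z') = frame 0 0 (x * y' - x' * y).
Proof.
apply/val_inj/matrixP => -[[|[|[|//]]] ?] [[|[|[|//]]] ?];
rewrite !mxE !big_ord_recl !big_ord0 !mxE -!val_eqE /=; ring.
Qed.

(** * Sign changes along a frame *)

Definition flip_fun (s t : R) (v : lieh) : lieh :=
  frame (s * coordX v) (t * coordY v) (s * t * coordZ v).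

Lemma flip_fun_linear s t : linear (flip_fun s t).
Proof.
move=> a u v; have [x [y [z ->]]] := frameP u; have [x' [y' [z' ->]]] := frameP v.
rewrite /flip_fun !(scale_frame, add_frame, coord_frame).
by congr frame; ring.
Qed.

HB.instance Definition _ s t :=
  GRing.isLinear.Build R lieh lieh _ (flip_fun s t) (flip_fun_linear s t).

Definition flip (s t : R) : 'End(lieh) := linfun (flip_fun s t).

Lemma flip_frame s t x y z :
  flip s t (frame x y z) = frame (s * x) (t * y) (s * t * z).
Proof. by rewrite lfunE /= /flip_fun !coord_frame. Qed.

Lemma flipM s t s' t' : flip (s * s') (t * t') = (flip s t \o flip s' t')%VF.
Proof.
apply/lfunP => v; have [x [y [z ->]]] := frameP v.
by rewrite comp_lfunE !flip_frame; congr frame; ring.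
Qed.

Lemma flip_inj s t s' t' : flip s t = flip s' t' -> s = s' /\ t = t'.
Proof.
move=> /(congr1 (fun f : 'End(lieh) => f (frame 1 1 0))).
rewrite !flip_frame !mulr1 => e.
by split; [move: (congr1 coordX e)|move: (congr1 coordY e)]; rewrite !coord_frame.
Qed.

(** The factor on Z must be s t because Z = [X, Y]. *)
Lemma flip_lie s t : s * s = 1 -> t * t = 1 -> lie_automorphism (flip s t).
Proof.
move=> ss tt; split.
  have fK : cancel (flip s t) (flip s t).
    move=> v; have [x [y [z ->]]] := frameP v.
    have st : s * t * (s * t) = 1 by rewrite mulrACA ss tt mulr1.
    by rewrite !flip_frame (mulrA s s) (mulrA t t) (mulrA (s * t)) ss tt st !mul1r.
  by exists (flip s t).
move=> u v; have [x [y [z ->]]] := frameP u; have [x' [y' [z' ->]]] := frameP v.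
by rewrite !(bracket_frame, flip_frame); congr frame; ring.
Qed.

(** * The symmetric structure of a frame *)

Lemma chi_sqr (gamma a : Z22) : chi R gamma a * chi R gamma a = 1.
Proof. by rewrite /chi -expr2 sqrr_sign. Qed.

Lemma chi_inj (gamma gamma' : Z22) :
  (forall a, chi R gamma a = chi R gamma' a) -> gamma = gamma'.
Proof.
have n1 : (1 : R) <> -1.
  by apply/eqP; rewrite eq_sym -subr_eq0 -opprD oppr_eq0 (pnatr_eq0 _ 2).
move=> e; have := e (0, 1); have := e (1, 0).
elim/forall_Z22: gamma {e}; elim/forall_Z22: gamma' => //;
by rewrite /chi /= ?expr0 ?expr1 // => ? ?; exfalso; apply: n1.
Qed.

(** The characters of the eigenvectors X, Y are indexed by (1, 0) and (0, 1),
    hence that of Z by their sum (1, 1). *)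
Definition frame_aut (a : Z22) : 'End(lieh) :=
  flip (chi R (1, 0) a) (chi R (0, 1) a).

Lemma frame_aut_lie a : lie_automorphism (frame_aut a).
Proof. by apply: flip_lie; exact: chi_sqr. Qed.

Lemma frame_autD a b : frame_aut (a + b) = (frame_aut a \o frame_aut b)%VF.
Proof.
by rewrite -flipM /frame_aut ![chi R _ (a + b)]chiC !chiD !(chiC _ _ (_, _)).
Qed.

Lemma frame_aut_inj : injective frame_aut.
Proof.
move=> a b /flip_inj[e1 e2]; apply: chi_inj; elim/forall_Z22.
- by rewrite /chi /= !muln0.
- by rewrite chiC e2 chiC.
- by rewrite chiC e1 chiC.
- have -> : (1, 1) = (1, 0) + (0, 1) :> Z22 by apply/eqP.
  by rewrite !(chiC _ _ (_ + _)) !chiD e1 e2.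
Qed.

(** X, Y and Z are eigenvectors with three distinct characters, so a component
    of the grading cannot mix them. *)
Lemma frame_component gamma x y z :
  frame x y z \in component frame_aut gamma ->
  [/\ gamma != (1, 0) -> x = 0, gamma != (0, 1) -> y = 0
    & gamma != (1, 1) -> z = 0].
Proof.
have eig (gamma' : Z22) c :
    (forall a, chi R gamma' a * c = chi R gamma a * c) ->
    gamma != gamma' -> c = 0.
  move=> e ne; apply/eqP; apply: contraNT ne => c0; apply/eqP/chi_inj => a.
  exact/esym/(mulIf c0)/e.
move=> /componentP h.
have {}h a : [/\ chi R (1, 0) a * x = chi R gamma a * x,
                 chi R (0, 1) a * y = chi R gamma a * y
               & chi R (1, 1) a * z = chi R gamma a * z].
  move: (h a); rewrite /frame_aut flip_frame scale_frame => e.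
  have -> : (1, 1) = (1, 0) + (0, 1) :> Z22 by apply/eqP.
  rewrite chiD; split.
  - by move: (congr1 coordX e); rewrite !coord_frame.
  - by move: (congr1 coordY e); rewrite !coord_frame.
  - by move: (congr1 coordZ e); rewrite !coord_frame.
by split; apply: eig => a; have [] := h a.
Qed.

Lemma frame_aut_fixed : component frame_aut 0 = 0%VS.
Proof.
apply/eqP; rewrite -subv0; apply/subvP => v.
have [x [y [z ->]]] := frameP v => /frame_component[-> // -> // -> //].
by rewrite frame_basis !scale0r !addr0 mem0v.
Qed.

Definition frame_structure : Z22_symmetric_structure R :=
  Z22SymmetricStructure frame_aut_lie frame_autD frame_aut_inj frame_aut_fixed.

End Frame.

(** * Orthogonal frames *)

Section Metric.
Context (R : realType) (g : riemannian_metric R).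
Local Notation lieh := (subvs_of (h3 R)).
Local Notation B := (g 1%g).

Lemma metricDl a (u v w : lieh) : B (a *: u + v) w = a * B u w + B v w.
Proof. exact: metric_linear. Qed.

Lemma metric0l (w : lieh) : B 0 w = 0.
Proof. by have := metricDl (-1) 0 0 w; rewrite scaler0 addr0 mulN1r addNr. Qed.

Lemma metricZl a (u w : lieh) : B (a *: u) w = a * B u w.
Proof. by rewrite -[a *: u]addr0 metricDl metric0l addr0. Qed.

(** Gram-Schmidt in the order Z, X, Y, without normalization: p, q, r are the
    usual projection coefficients, and the third vector of a frame is Z for
    every choice of them. *)
Lemma exists_orthogonal_frame : exists p q r,
  [/\ B (frame p q r 1 0 0) (frame p q r 0 1 0) = 0,
      B (frame p q r 1 0 0) (frame p q r 0 0 1) = 0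
    & B (frame p q r 0 1 0) (frame p q r 0 0 1) = 0].
Proof.
pose E : lieh := frame 0 0 0 1 0 0.
pose F : lieh := frame 0 0 0 0 1 0.
pose Z : lieh := frame 0 0 0 0 0 1.
have Z0 : B Z Z != 0.
  rewrite gt_eqF // metric_pos //; apply/eqP => /(congr1 (coordZ 0 0)).
  by rewrite coord_frame /coordZ /= !mxE !mulr0 !subr0 => /eqP; rewrite oner_eq0.
pose p := - (B E Z / B Z Z); pose X := p *: Z + E.
have X0 : B X X != 0.
  rewrite gt_eqF // metric_pos //; apply/eqP => /(congr1 (coordX 0)).
  rewrite /X scale_frame add_frame coord_frame /coordX /= !mxE.
  by rewrite !mulr0 subr0 add0r => /eqP; rewrite oner_eq0.
have XZ : B X Z = 0 by rewrite metricDl mulNr divfK // addNr.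
have eX q r : frame p q r 1 0 0 = X.
  by apply/val_inj/matrixP => i j; rewrite /= !mxE; ring.
have eY q r : frame p q r 0 1 0 = q *: X + (r *: Z + F).
  by apply/val_inj/matrixP => i j; rewrite /= !mxE; ring.
have eZ q r : frame p q r 0 0 1 = Z.
  by apply/val_inj/matrixP => i j; rewrite /= !mxE; ring.
(* Otherwise bilinearity would also expand the sum inside X. *)
clearbody X Z; exists p, (- (B F X / B X X)), (- (B F Z / B Z Z)).
rewrite eX eY eZ; split=> //.
  rewrite Defs.metric_sym !metricDl (Defs.metric_sym g _ Z) XZ mulr0 add0r.
  by rewrite mulNr divfK // addNr.
by rewrite !metricDl XZ mulr0 add0r mulNr divfK // addNr.
Qed.

Lemma metric_frame p q r x y z x' y' z' :
  B (frame p q r 1 0 0) (frame p q r 0 1 0) = 0 ->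
  B (frame p q r 1 0 0) (frame p q r 0 0 1) = 0 ->
  B (frame p q r 0 1 0) (frame p q r 0 0 1) = 0 ->
  B (frame p q r x y z) (frame p q r x' y' z') =
    x * x' * B (frame p q r 1 0 0) (frame p q r 1 0 0) +
    y * y' * B (frame p q r 0 1 0) (frame p q r 0 1 0) +
    z * z' * B (frame p q r 0 0 1) (frame p q r 0 0 1).
Proof.
rewrite (frame_basis _ _ _ x y z) (frame_basis _ _ _ x' y' z').
set X := frame _ _ _ 1 0 0; set Y := frame _ _ _ 0 1 0; set Z := frame _ _ _ 0 0 1.
move=> XY XZ YZ; rewrite !metricDl metricZl ![B _ (_ + _)]Defs.metric_sym.
rewrite !metricDl !metricZl (Defs.metric_sym g _ Y X) (Defs.metric_sym g _ Z X).
by rewrite (Defs.metric_sym g _ Z Y) XY XZ YZ; ring.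
Qed.

End Metric.

Theorem corollary19 (R : realType) (g : riemannian_metric R) :
  (exists S : Z22_symmetric_structure R, Z22_symmetric_metric S g) <->
  left_invariant g.
Proof.
split=> [[S []] // | gL].
have [p [q [r [XY XZ YZ]]]] := exists_orthogonal_frame g.
exists (frame_structure p q r); split=> // gamma gamma' _ _ ne v w.
have [x [y [z ->]]] := frameP p q r v.
have [x' [y' [z' ->]]] := frameP p q r w.
move=> /frame_component[hx hy hz] /frame_component[hx' hy' hz'].
(* Two distinct components never share a basis vector of the frame. *)
have disj (c c' : R) (delta : Z22) :
    (gamma != delta -> c = 0) -> (gamma' != delta -> c' = 0) -> c * c' = 0.
  move=> h h'; have [e|/h->] := eqVneq gamma delta; last by rewrite mul0r.
  by rewrite h' ?mulr0 // -e eq_sym.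
rewrite metric_frame // (disj _ _ _ hx hx') (disj _ _ _ hy hy').
by rewrite (disj _ _ _ hz hz') !mul0r !addr0.
Qed.
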